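(* Let $k$ be an algebraically closed field, let $\ell\geq 2$, and let $\underline x=(x_1,\ldots,x_\ell)$ be indeterminates. Let $P,Q\in k[\underline x]$ be such that: ( * ) $\Gamma(P)$ is contained in a hyperplane $H\subset\mathbb{R}^\ell$ not passing through the origin; (a) the coordinates of all the vertices of $\Gamma(P)$ are relatively prime (i.e. the greatest common divisor of all the coordinates of all the vertices is $1$); (b) $Q(0,\ldots,0)\neq 0$, $\Gamma(Q)\subset\Gamma_0(P)$ and no monomial of $Q$ is a vertex of $\Gamma(P)$. Then the polynomial $F=P-tQ$, with $t$ an indeterminate, is generically irreducible, that is, irreducible in $\overline{k(t)}[\underline x]$, and even has this stronger property: $P-t^\ast Q$ is irreducible in $k[\underline x]$ for every $t^\ast\in k\setminus\{0\}$.
   Context: Monomials $x_1^{i_1}\cdots x_\ell^{i_\ell}$ are identified with their exponents $(i_1,\ldots,i_\ell)\in\mathbb{R}^\ell$. The support $\mathrm{supp}(P)$ of $P\in k[\underline x]$ is the set of monomials appearing in $P$ with a non-zero coefficient. The Newton polyhedron $\Gamma(P)$ is the convex hull in $\mathbb{R}^\ell$ of $\mathrm{supp}(P)$, and $\Gamma_0(P)$ is the convex hull of $\mathrm{supp}(P)\cup\{0\}$. ''A monomial of $Q$'' means an element of $\mathrm{supp}(Q)$. $\overline{k(t)}$ denotes an algebraic closure of $k(t)$. *)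

(* Defs.v *)
From mathcomp Require Import all_boot all_order all_algebra.
From mathcomp Require Import mpoly.
From mathcomp Require Import interval_inference.
From mathcomp Require Import boolp classical_sets reals convex.

Set Implicit Arguments.
Unset Strict Implicit.
Unset Printing Implicit Defensive.

Import Order.TTheory GRing.Theory Num.Theory.

Local Open Scope classical_set_scope.
Local Open Scope ring_scope.

Section ConvexGeometry.
Variable R : realType.

Lemma convex_setP (V : lmodType R) (A : set V) :
  @convex_set R V A <->
  forall (x y : V) (a : R), A x -> A y -> 0 < a < 1 ->
    A (a *: x + (1 - a) *: y).
Proof.
rewrite convex_setW; split=> [cA x y a Ax Ay /andP[a0 a1]|cA x y].
  have /= := cA x y (mem_set Ax) (mem_set Ay) (Itv01 (ltW a0) (ltW a1)) a0 a1.
  by rewrite inE.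
rewrite !inE => Ax Ay a a0 a1; rewrite inE.
by apply: cA => //; rewrite a0.
Qed.

Definition convex_hull (V : lmodType R) (A : set V) : set V :=
  smallest (@convex_set R V) A.

(* The vertices of a polytope are taken to be its extreme points. *)
Definition vertices (V : lmodType R) (C : set V) : set V :=
  [set v | C v /\ forall (x y : V) (a : R), C x -> C y -> 0 < a < 1 ->
                    v = a *: x + (1 - a) *: y -> x = y].

Definition is_hyperplane (l : nat) (H : set 'rV[R]_l) : Prop :=
  exists (w : 'rV[R]_l) (c : R),
    w != 0 /\ H = [set u | \sum_(i < l) w 0 i * u 0 i = c].

Lemma vertices_convex_hull (V : lmodType R) (A : set V) :
  vertices (convex_hull A) `<=` A.
Proof.
move=> v [hv ext]; apply: contrapT => nAv.
have sA : A `<=` convex_hull A by move=> u Au C [_]; apply.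
have cC (x y : V) (a : R) : convex_hull A x -> convex_hull A y -> 0 < a < 1 ->
    convex_hull A (a *: x + (1 - a) *: y).
  move=> hx hy a01 C [cC AC].
  have /convex_setP := cC; apply=> //; [exact: hx | exact: hy].
suff : [set u | convex_hull A u /\ u <> v] v by case.
apply: hv; split=> [|u Au /=]; last first.
  by split; [exact: sA | move=> uv; apply: nAv; rewrite -uv].
apply/convex_setP => x y a /= [xC xv] [yC yv] a01; split; first exact: cC.
move/esym => va; have xy := ext _ _ _ xC yC a01 va.
by apply: xv; rewrite va -xy -scalerDl addrC subrK scale1r.
Qed.

End ConvexGeometry.

Section NewtonPolyhedron.
Variables (R : realType) (k : nzRingType) (l : nat).
Implicit Type P : {mpoly k[l]}.

Definition exponent (m : 'X_{1..l}) : 'rV[R]_l := \row_(i < l) (m i)%:R.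

(* Gamma(P) *)
Definition newton P : set 'rV[R]_l :=
  convex_hull (exponent @` [set m | m \in msupp P]).

(* Gamma_0(P) *)
Definition newton0 P : set 'rV[R]_l :=
  convex_hull (exponent @` [set m | m \in msupp P] `|` [set 0]).

Lemma vertices_newton P (v : 'rV[R]_l) :
  vertices (newton P) v -> exists2 m, m \in msupp P & exponent m = v.
Proof. by move=> /vertices_convex_hull[m mP <-]; exists m. Qed.

(* By vertices_newton, every vertex of Gamma(P) is the exponent of exactly one
   of these monomials. *)
Definition vertex_monomials P : seq 'X_{1..l} :=
  [seq m <- msupp P | `[< vertices (newton P) (exponent m) >]].

Definition vertex_coord_gcd P : nat :=
  \big[gcdn/0%N]_(m <- vertex_monomials P) \big[gcdn/0%N]_(i < l) m i.

End NewtonPolyhedron.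

Arguments exponent R {l} m.
Arguments newton R {k l} P.
Arguments newton0 R {k l} P.
Arguments vertex_monomials R {k l} P.
Arguments vertex_coord_gcd R {k l} P.

Definition irreducible (A : idomainType) (p : A) : Prop :=
  [/\ p != 0, p \isn't a GRing.unit &
      forall a b : A, p = a * b -> a \is a GRing.unit \/ b \is a GRing.unit].

(* L, seen as an extension of K through iota, is an algebraic closure of K. *)
Definition is_algebraic_closure (K : fieldType) (L : closedFieldType)
    (iota : {rmorphism K -> L}) : Prop :=
  forall z : L, algebraicOver iota z.

(* The indeterminate t is 'X in {poly k}, and k(t) is {fraction {poly k}}.
   Algebraic closures being unique up to isomorphism, "irreducible in
   \overline{k(t)}[x]" is expressed over every algebraic closure of k(t). *)
Definition generically_irreducible (k : fieldType) (l : nat)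
    (F : {mpoly {poly k}[l]}) : Prop :=
  forall (L : closedFieldType) (iota : {rmorphism {fraction {poly k}} -> L}),
    is_algebraic_closure iota ->
    irreducible (map_mpoly (iota \o @tofrac _) F).

(* Main.v *)
(* If P - t Q = a b, Ostrowski's theorem places supp a + supp b inside the
   pyramid Gamma_0(P) with apex 0; both supports contain 0 since Q(0) is nonzero.
   Let f be the linear form equal to 1 on H. A vertex v of Gamma(P) lies in the
   support of P - t Q, hence splits as v = v_a + v_b, and extremality forces
   v_a = f(v_a) v. Since f is at most 1 on supp a + supp b, the ratio
   alpha = f(v_a) does not depend on v. All coordinates of all alpha v are
   integers, so alpha is an integer by (a), and alpha = 0 (resp. 1) makes a
   (resp. b) constant. *)
Require Import Defs.
From HB Require Import structures.
From mathcomp Require Import all_boot all_order all_algebra.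
From mathcomp Require Import mpoly.
From mathcomp Require Import boolp classical_sets reals.
From mathcomp Require Import ring lra.

Set Implicit Arguments.
Unset Strict Implicit.

Import Order.TTheory GRing.Theory Num.Theory.

Local Open Scope classical_set_scope.
Local Open Scope ring_scope.

(** * Convex hulls: adding an apex, and generation by vertices *)

Section ConvexHull.
Variables (R : realType) (V : lmodType R).
Implicit Types (A B C : set V) (x y t u v : V) (a s : R) (S : seq V).

Lemma sub_convex_hull A : A `<=` convex_hull A.
Proof. exact: sub_smallest. Qed.

Lemma convex_hull_min A C :
  (forall x y a, C x -> C y -> 0 < a < 1 -> C (a *: x + (1 - a) *: y)) ->
  A `<=` C -> convex_hull A `<=` C.
Proof. by move=> /convex_setP cC AC; apply: smallest_sub. Qed.

Lemma convex_hull_comb {A x y a} : convex_hull A x -> convex_hull A y ->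
  0 < a < 1 -> convex_hull A (a *: x + (1 - a) *: y).
Proof.
move=> Ax Ay a01 C [cC AC].
by have /convex_setP := cC; apply=> //; [exact: Ax | exact: Ay].
Qed.

Lemma convex_hull_sub A B : A `<=` convex_hull B ->
  convex_hull A `<=` convex_hull B.
Proof. by apply: convex_hull_min => x y a; apply: convex_hull_comb. Qed.

Lemma convex_hull_mono A B : A `<=` B -> convex_hull A `<=` convex_hull B.
Proof.
by move=> AB; apply: convex_hull_sub => x /AB; apply: sub_convex_hull.
Qed.

Lemma comb_gt0 a s s' : 0 < a < 1 -> 0 <= s -> 0 <= s' -> 0 < s + s' ->
  0 < a * s + (1 - a) * s'.
Proof.
move=> /andP[a0]; rewrite -subr_gt0 => b0.
rewrite le_eqVlt => /predU1P[<-|s0] s'0.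
  by rewrite add0r mulr0 add0r; apply: mulr_gt0.
by move=> _; rewrite ltr_pwDl ?mulr_gt0 ?mulr_ge0 // ltW.
Qed.

(** The combination lies on a third ray from [x], whose base [t0] is the mean of [t] and [t'] with
    weights proportional to [a * s] and [(1 - a) * s']. *)
Lemma ray_comb A x t t' a s s' : convex_hull A t -> convex_hull A t' ->
  0 < a < 1 -> 0 <= s -> 0 <= s' -> 0 < s + s' ->
  exists2 t0, convex_hull A t0 &
    a *: (x + s *: (t - x)) + (1 - a) *: (x + s' *: (t' - x)) =
    x + (a * s + (1 - a) * s') *: (t0 - x).
Proof.
move=> At At' /andP[a0 a1] s0 s'0 ss'.
have b0 : 0 < 1 - a by rewrite subr_gt0.
have eqx : a *: x + (1 - a) *: x = x by rewrite -scalerDl addrC subrK scale1r.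
(* A zero parameter would give a weight 0 or 1, outside the range of [convex_hull_comb]. *)
have [s_eq0|s_neq0] := eqVneq s 0.
  exists t' => //.
  by rewrite s_eq0 scale0r addr0 mulr0 add0r scalerDr addrA eqx scalerA.
have [s'_eq0|s'_neq0] := eqVneq s' 0.
  exists t => //.
  by rewrite s'_eq0 scale0r addr0 mulr0 addr0 scalerDr addrAC eqx scalerA.
have as0 : 0 < a * s by rewrite mulr_gt0 // lt_def s_neq0.
have bs0 : 0 < (1 - a) * s' by rewrite mulr_gt0 // lt_def s'_neq0.
set c := a * s + (1 - a) * s'.
have c0 : 0 < c by rewrite addr_gt0.
have cl : c * (a * s / c) = a * s by rewrite mulrC divfK ?gt_eqF.
have cr : c * (1 - a * s / c) = (1 - a) * s'.
  by rewrite mulrBr mulr1 cl /c addrC addKr.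
exists ((a * s / c) *: t + (1 - a * s / c) *: t').
  apply: convex_hull_comb => //.
  by rewrite divr_gt0 // ltr_pdivrMr // mul1r /c ltrDl.
rewrite !(scalerDr, scalerN, scalerA) cl cr addrACA eqx; congr (_ + _).
by rewrite addrACA -opprD -scalerDl.
Qed.

(** The union of the segments from [x] to the hull of [A] is already convex, by [ray_comb]. The apex
    is listed apart, which also covers an empty [A]. *)
Lemma convex_hull_setU1 A x u : convex_hull (A `|` [set x]) u ->
  u = x \/ exists s t, [/\ 0 < s <= 1, convex_hull A t & u = x + s *: (t - x)].
Proof.
move: u; apply: convex_hull_min => [u v a|u [Au|->]]; last by left.
- move=> hu hv /[dup] a01 /andP[a0 a1].
  have b0 : 0 < 1 - a by rewrite subr_gt0.
  have mk s s' t t' : 0 <= s <= 1 -> 0 <= s' <= 1 -> 0 < s + s' ->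
      convex_hull A t -> convex_hull A t' ->
      exists r t0, [/\ 0 < r <= 1, convex_hull A t0 &
        a *: (x + s *: (t - x)) + (1 - a) *: (x + s' *: (t' - x)) =
        x + r *: (t0 - x)].
    move=> /andP[s0 s1] /andP[s'0 s'1] ss' At At'.
    have [t0 At0 ->] := @ray_comb A x t t' a s s' At At' a01 s0 s'0 ss'.
    exists (a * s + (1 - a) * s'), t0; split=> //.
    by rewrite comb_gt0 //=; nra.
  case: hu => [->|[s [t [/andP[s0 s1] At ->]]]].
    case: hv => [->|[s' [t' [/andP[s'0 s'1] At' ->]]]].
      by left; rewrite -scalerDl addrC subrK scale1r.
    (* The apex is [x + 0 *: (t' - x)], so [mk] also settles the mixed cases. *)
    right; have := mk 0 s' t' t'.
    rewrite scale0r [x + 0]addr0; apply;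
      by rewrite ?lexx ?ler01 ?add0r ?(ltW s'0).
  case: hv => [->|[s' [t' [/andP[s'0 s'1] At' ->]]]].
    right; have := mk s 0 t t.
    rewrite scale0r [x + 0]addr0; apply;
      by rewrite ?lexx ?ler01 ?addr0 ?(ltW s0).
  by right; apply: mk; rewrite ?(ltW s0) ?(ltW s'0) ?addr_gt0.
- right; exists 1, u; split; first by rewrite ltr01 lexx.
    exact: sub_convex_hull.
  by rewrite scale1r addrC subrK.
Qed.

(* Discarding superfluous generators one at a time leaves a generating set in
   which no point is in the hull of the others: such points are vertices. *)
Lemma convex_hull_vertices S :
  convex_hull [set` S] `<=` convex_hull (vertices (convex_hull [set` S])).
Proof.
have [n] := ubnP (size S); elim: n S => // n IH S szS.
have [[x xS hx]|nex] := pselect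
    (exists2 x, x \in S & convex_hull [set` [seq y <- S | y != x]] x).
  set S' := [seq y <- S | y != x] in hx.
  have -> : convex_hull [set` S] = convex_hull [set` S'].
    apply/seteqP; split; last first.
      by apply: convex_hull_mono => y /=; rewrite mem_filter => /andP[].
    apply: convex_hull_sub => y /= yS; have [->//|yx] := eqVneq y x.
    by apply: sub_convex_hull; rewrite /= mem_filter yx.
  apply: IH; rewrite -ltnS (leq_trans _ szS) // ltnS size_filter.
  by rewrite -(count_predC (pred1 x) S) -[ltnLHS]add0n ltn_add2r
    -has_count has_pred1.
apply: convex_hull_mono => x /= xS; split; first exact: sub_convex_hull.
set A := [set` [seq y <- S | y != x]].
have nAx : ~ convex_hull A x by move=> Ax; apply: nex; exists x.
have sub : [set` S] `<=` A `|` [set x].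
  move=> y /= yS; have [->|yx] := eqVneq y x; [by right | left].
  by rewrite /A /= mem_filter yx.
(* By [ray_comb] the right-hand side is [x + c *: (t0 - x)] with [c > 0], so equality would put
   [x = t0] in the hull of [A]. *)
have no s s' t t' a : convex_hull A t -> convex_hull A t' -> 0 < a < 1 ->
    0 <= s -> 0 <= s' -> 0 < s + s' ->
    x <> a *: (x + s *: (t - x)) + (1 - a) *: (x + s' *: (t' - x)).
  move=> At At' /[dup] a01 /andP[a0 a1] s0 s'0 ss'.
  have [t0 At0 ->] := @ray_comb A x t t' a s s' At At' a01 s0 s'0 ss'.
  move=> /eqP; rewrite eq_sym -subr_eq0 addrAC subrr add0r scaler_eq0.
  case/orP => [/eqP/esym|]; first by apply/eqP; rewrite lt_eqF ?comb_gt0.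
  by rewrite subr_eq0 => /eqP E; apply: nAx; rewrite -E.
move=> y z a /(convex_hull_mono sub)/convex_hull_setU1 hy.
move=> /(convex_hull_mono sub)/convex_hull_setU1 hz a01.
case: hy => [->|[s [t [/andP[s0 s1] At ->]]]].
  case: hz => [->//|[s' [t' [/andP[s'0 s'1] At' ->]]]] E.
  by case: (@no 0 s' t' t' a); rewrite ?add0r ?(ltW s'0) // scale0r addr0.
case: hz => [->|[s' [t' [/andP[s'0 s'1] At' ->]]]] E.
  by case: (@no s 0 t t a); rewrite ?addr0 ?(ltW s0) // scale0r addr0.
by case: (@no s s' t t' a); rewrite ?(ltW s0) ?(ltW s'0) ?addr_gt0.
Qed.

End ConvexHull.

(** * Newton polyhedra of products *)

Section NewtonProduct.
Variables (R : realType) (l : nat).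
Implicit Types (m n : 'X_{1..l}).

Lemma exponent0 : exponent R (0%MM : 'X_{1..l}) = 0.
Proof. by apply/rowP => i; rewrite !mxE mnm0E. Qed.

Lemma exponentD m n : exponent R (m + n)%MM = exponent R m + exponent R n.
Proof. by apply/rowP => i; rewrite !mxE mnmDE natrD. Qed.

Lemma exponent_inj : injective (@exponent R l).
Proof.
move=> m n /rowP E; apply/mnmP => i.
by have := E i; rewrite !mxE => /eqP; rewrite eqr_nat => /eqP.
Qed.

(** In the convolution sum, every pair other than [(m1, m2)] has a member outside the support of its
    factor. *)
Lemma mcoeffM_uniq (K : nzRingType) (p q : {mpoly K[l]}) m1 m2 :
  (forall n1 n2, n1 \in msupp p -> n2 \in msupp q ->
     (n1 + n2 = m1 + m2)%MM -> n1 = m1) ->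
  (p * q)@_(m1 + m2) = p@_m1 * q@_m2.
Proof.
move=> uniq12; rewrite mcoeffM.
have lt1 : (mdeg m1 < (mdeg (m1 + m2)%MM).+1)%N by rewrite ltnS mdegD leq_addr.
have lt2 : (mdeg m2 < (mdeg (m1 + m2)%MM).+1)%N by rewrite ltnS mdegD leq_addl.
rewrite (bigD1 (BMultinom lt1, BMultinom lt2)) //= big1 ?addr0 //.
move=> [k1 k2] /= /andP[/eqP eq12 neq12].
have [k1p|/memN_msupp_eq0->] := boolP ((k1 : 'X_{1..l}) \in msupp p);
  last by rewrite mul0r.
have [k2q|/memN_msupp_eq0->] := boolP ((k2 : 'X_{1..l}) \in msupp q);
  last by rewrite mulr0.
have k1m := uniq12 _ _ k1p k2q (esym eq12).
have k2m : bmnm k2 = m2 by apply/esym/(@addmI _ m1); rewrite -{2}k1m.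
by case/eqP: neq12; congr (_, _); apply: val_inj.
Qed.

(* Ostrowski: a vertex of the Minkowski sum splits uniquely as a sum of
   exponents of p and q, so no cancellation occurs there in p * q. *)
Lemma newton_mul (K : idomainType) (p q : {mpoly K[l]}) m1 m2 :
  m1 \in msupp p -> m2 \in msupp q ->
  newton R (p * q) (exponent R m1 + exponent R m2).
Proof.
move=> m1p m2q.
set S := [seq exponent R (n1 + n2)%MM | n1 <- msupp p, n2 <- msupp q].
have inS n1 n2 : n1 \in msupp p -> n2 \in msupp q ->
    convex_hull [set` S] (exponent R (n1 + n2)%MM).
  move=> n1p n2q; apply: sub_convex_hull => /=.
  by apply/allpairsP; exists (n1, n2).
rewrite -exponentD; have /convex_hull_vertices := inS _ _ m1p m2q.
(* It remains to see that each vertex of the hull of [S] comes from a monomial of [p * q]. *)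
apply: convex_hull_mono => v /[dup] /vertices_convex_hull /= /allpairsP.
move=> [[n1 n2] /= [n1p n2q ->]] [_ ext]; exists (n1 + n2)%MM => //=.
rewrite mcoeff_msupp mcoeffM_uniq; last first.
  move=> k1 k2 k1p k2q eqkn.
  have half : 0 < (2^-1 : R) < 1 by rewrite invr_gt0 invf_lt1 ?ltr0n ?ltr1n.
  (* Exchanging summands: the vertex is the midpoint of [k1 + n2] and [n1 + k2], so these coincide
     with it and [k1 = n1]. *)
  have e : exponent R (n1 + n2)%MM =
      2^-1 *: exponent R (k1 + n2)%MM + (1 - 2^-1) *: exponent R (n1 + k2)%MM.
    apply/rowP => i; rewrite !mxE.
    have := congr1 (fun m : 'X_{1..l} => (m i)%:R : R) eqkn.
    by rewrite !mnmDE !natrD => ?; lra.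
  have E := ext _ _ _ (inS _ _ k1p n2q) (inS _ _ n1p k2q) half e.
  move: e; rewrite -E -scalerDl addrC subrK scale1r => /exponent_inj e.
  by apply: (@addIm _ n2); rewrite e.
by rewrite mulf_neq0 // -mcoeff_msupp.
Qed.

End NewtonProduct.

(** * Integrality through gcds, and constant polynomials *)

Lemma int_mul_gcdn (R : realType) (a : R) (m n : nat) :
  a * m%:R \is a Num.int ->
  a * n%:R \is a Num.int -> a * (gcdn m n)%:R \is a Num.int.
Proof.
move=> am an; have [->|m0] := posnP m; first by rewrite gcd0n.
case: (egcdnP n m0) => u v E _.
(* Bézout: [u * m = v * n + gcdn m n]. *)
have -> : a * (gcdn m n)%:R = u%:R * (a * m%:R) - v%:R * (a * n%:R).
  have := congr1 (fun n : nat => n%:R : R) E.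
  rewrite /= natrD !natrM => e.
  have -> : u%:R * (a * m%:R) = a * (u%:R * m%:R) by ring.
  by rewrite e; ring.
by rewrite rpredB // rpredM // natr_int.
Qed.

Lemma int_mul_vertex_coord_gcd (R : realType) (k : nzRingType) (l : nat)
    (P : {mpoly k[l]}) (a : R) :
  (forall m i, m \in vertex_monomials R P -> a * (m i)%:R \is a Num.int) ->
  a * (vertex_coord_gcd R P)%:R \is a Num.int.
Proof.
move=> aint; have a0 : a * 0%:R \is a Num.int by rewrite mulr0 rpred0.
pose Z n := a * n%:R \is a Num.int.
rewrite /vertex_coord_gcd big_seq; apply: (big_ind Z) => // [x y|m mV].
  exact: int_mul_gcdn.
by apply: (big_ind Z) => // [x y|i _]; [exact: int_mul_gcdn | exact: aint].
Qed.

Lemma msupp_sub0_unit (K : fieldType) (l : nat) (p : {mpoly K[l]}) :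
  0%MM \in msupp p ->
  (forall m, m \in msupp p -> m = 0%MM) -> p \is a GRing.unit.
Proof.
move=> p0 psub; have -> : p = (p@_0)%:MP.
  apply/mpolyP => m; rewrite mcoeffC; have [->|m0] := eqVneq.
    by rewrite mulr1.
  by rewrite mulr0 memN_msupp_eq0 //; apply: contra_neqN m0; apply: psub.
by rewrite rmorph_unit // unitfE -mcoeff_msupp.
Qed.

(** * Factorizations inside the pyramid with apex 0 *)

Section Pyramid.
Variables (R : realType) (k : nzRingType) (l : nat) (P : {mpoly k[l]}).
Variable f : {scalar 'rV[R]_l}.
Hypothesis fP : forall u, newton R P u -> f u = 1.

(** In the second case [s] is the height [f u]; the bounds on [f] over the pyramid follow from
    this. *)
Lemma newton0P u : newton0 R P u ->
  u = 0 \/ exists s v, [/\ 0 < s <= 1, newton R P v & u = s *: v].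
Proof.
move=> /convex_hull_setU1[->|[s [v [s01 Pv ->]]]]; [by left | right].
by exists s, v; rewrite subr0 add0r.
Qed.

Lemma newton0_ge0 u : newton0 R P u -> 0 <= f u.
Proof.
move=> /newton0P[->|[s [v [/andP[/ltW s0 _] Pv ->]]]]; first by rewrite linear0.
by rewrite linearZ /= fP // mulr1.
Qed.

Lemma newton0_le1 u : newton0 R P u -> f u <= 1.
Proof.
move=> /newton0P[->|[s [v [/andP[_ s1] Pv ->]]]].
  by rewrite linear0 ler01.
by rewrite linearZ /= fP // mulr1.
Qed.

Lemma newton0_le0 u : newton0 R P u -> f u <= 0 -> u = 0.
Proof.
move=> /newton0P[->//|[s [v [/andP[s0 _] Pv ->]]]].
by rewrite linearZ /= fP // mulr1 leNgt s0.
Qed.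

(** Write [x = s *: p] and [y = r *: q] with [p], [q] in the base. Applying [f] gives [s + r = 1],
    so [v] is a convex combination of [p] and [q], and extremality yields [p = q = v]. *)
Lemma vertex_split v x y : vertices (newton R P) v ->
  newton0 R P x -> newton0 R P y -> v = x + y -> x = f x *: v.
Proof.
move=> [Pv ext] /newton0P[->|[s [p [/andP[s0 _] Pp xE]]]].
  by rewrite linear0 scale0r.
move=> /newton0P[->|[r [q [/andP[r0 _] Pq yE]]]] vE.
  by move: vE; rewrite addr0 => <-; rewrite fP // scale1r.
have rE : r = 1 - s.
  have := fP Pv; rewrite vE linearD xE yE !linearZ /= !fP // !mulr1 => <-.
  by rewrite addrC addKr.
have pq : p = q.
  apply: (ext _ _ s) => //; first by rewrite s0 -subr_gt0 -rE.
  by rewrite vE xE yE rE.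
have vp : v = p by rewrite vE xE yE rE -pq -scalerDl addrC subrK scale1r.
by rewrite vp xE linearZ /= fP // mulr1.
Qed.

Lemma pyramid_irreducible (K : fieldType) (F : {mpoly K[l]}) :
  vertex_coord_gcd R P = 1%N -> 0%MM \in msupp F ->
  {subset vertex_monomials R P <= msupp F} ->
  (forall m, m \in msupp F -> newton0 R P (exponent R m)) ->
  irreducible F.
Proof.
move=> gcd1 F0 VF FP.
have vertexP m : m \in vertex_monomials R P ->
    vertices (newton R P) (exponent R m).
  by rewrite mem_filter => /andP[/asboolP].
have fV m : m \in vertex_monomials R P -> f (exponent R m) = 1.
  by move=> /vertexP[/fP].
(* The gcd over an empty list is 0, so a gcd of 1 forces a vertex to exist. *)
have [m0 m0V] : exists m, m \in vertex_monomials R P.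
  move: gcd1; rewrite /vertex_coord_gcd.
  case: (vertex_monomials R P) => [|m s _]; first by rewrite big_nil.
  by exists m; rewrite mem_head.
split.
- by apply/eqP => FE; move: F0; rewrite FE msupp0.
(* A unit is constant, so the vertex monomial [m0] would be 0, where [f] is 0 and not 1. *)
- apply/negP => /andP[/eqP FE _]; have := VF _ m0V; rewrite FE msuppC.
  case: ifP => // _; rewrite inE => /eqP m00.
  by have /eqP := fV _ m0V; rewrite m00 exponent0 linear0 eq_sym oner_eq0.
move=> a b FE.
have [a0 b0] : 0%MM \in msupp a /\ 0%MM \in msupp b.
  apply/andP; move: F0; rewrite FE !mcoeff_msupp rmorphM /=.
  by rewrite mulf_eq0 negb_or.
have abP n1 n2 : n1 \in msupp a -> n2 \in msupp b ->
    newton0 R P (exponent R n1 + exponent R n2).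
  move=> n1a n2b; have := newton_mul (R := R) n1a n2b; rewrite -FE.
  by apply: convex_hull_sub => _ [m mF <-]; apply: FP.
have aP n : n \in msupp a -> newton0 R P (exponent R n).
  by move=> na; have := abP _ _ na b0; rewrite exponent0 addr0.
have bP n : n \in msupp b -> newton0 R P (exponent R n).
  by move=> nb; have := abP _ _ a0 nb; rewrite exponent0 add0r.
have fab n1 n2 : n1 \in msupp a -> n2 \in msupp b ->
    f (exponent R n1) + f (exponent R n2) <= 1.
  by move=> n1a n2b; rewrite -linearD; apply: newton0_le1; apply: abP.
have splitV m : m \in vertex_monomials R P -> exists n1 n2,
    [/\ n1 \in msupp a, n2 \in msupp b,
      f (exponent R n1) + f (exponent R n2) = 1 &
      exponent R n1 = f (exponent R n1) *: exponent R m].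
  move=> mV; have := VF _ mV; rewrite FE => /msuppM_le /allpairsP.
  move=> [[n1 n2] /= [n1a n2b mE]]; exists n1, n2; split=> //.
    by rewrite -linearD -exponentD -mE fV.
  apply: vertex_split (vertexP _ mV) (aP _ n1a) (bP _ n2b) _.
  by rewrite mE exponentD.
have [n1 [n2 [n1a n2b n12 _]]] := splitV _ m0V.
set alpha := f (exponent R n1) in n12.
have alpha_int : alpha \is a Num.int.
  have := @int_mul_vertex_coord_gcd R k l P alpha.
  rewrite gcd1 mulr1; apply=> m i mV.
  have [n1' [n2' [n1'a n2'b n12' n1'E]]] := splitV _ mV.
  (* Cross the two splittings: [n1 + n2'] and [n1' + n2] both have height at most 1, while [n1 + n2]
     and [n1' + n2'] have height exactly 1. *)
  have alphaE : f (exponent R n1') = alpha.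
    have := fab _ _ n1a n2'b; have := fab _ _ n1'a n2b; rewrite -/alpha; lra.
  move: n1'E; rewrite alphaE => /rowP /(_ i); rewrite !mxE => <-.
  exact: natr_int.
have [alpha0|alpha1] : alpha = 0 \/ alpha = 1.
  have := newton0_ge0 (aP _ n1a); have := newton0_le1 (aP _ n1a).
  rewrite -/alpha; have /intrP[z ->] := alpha_int.
  rewrite ler0z -[1]/(1%:~R) ler_int.
  by case: z => [[|[|z]]|z] // _ _; [left | right].
(* Now [n2] has height 1, leaving height at most 0 for each monomial of [a]; only the apex
   qualifies. *)
- left; apply: msupp_sub0_unit => // m ma; apply: (@exponent_inj R).
  rewrite exponent0; apply: newton0_le0 (aP _ ma) _.
  by have := fab _ _ ma n2b; lra.
- right; apply: msupp_sub0_unit => // m mb; apply: (@exponent_inj R).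
  rewrite exponent0; apply: newton0_le0 (bP _ mb) _.
  by have := fab _ _ n1a mb; rewrite -/alpha; lra.
Qed.

End Pyramid.

(** * From the hypotheses on P and Q to the pyramid *)

Lemma hyperplane_form (R : realType) (l : nat) (H : set 'rV[R]_l) :
  is_hyperplane H -> ~ H 0 ->
  exists f : {scalar 'rV[R]_l}, forall u, H u -> f u = 1.
Proof.
move=> [w [c [_ ->]]] /= H0.
have c0 : c != 0.
  apply/eqP => c0; apply: H0; rewrite c0 big1 // => i _.
  by rewrite mxE mulr0.
(* The equation of [H], normalized by its nonzero constant term. *)
pose g (u : 'rV[R]_l) := c^-1 * \sum_(i < l) w 0 i * u 0 i.
have g_scalar : scalar g.
  move=> a u v; rewrite /g mulrCA -mulrDr [a * _]mulr_sumr -big_split /=.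
  by congr (_ * _); apply: eq_bigr => i _; rewrite !mxE; ring.
pose f : {scalar 'rV[R]_l} :=
  HB.pack g (GRing.isLinear.Build R 'rV[R]_l R *%R g g_scalar).
by exists f => u uH; rewrite /= /g uH mulVf.
Qed.

(** Serves both claims: [j] is the identity of [k] for a fixed nonzero value of t, and the embedding
    of [k] into a closure of k(t) for the generic one. A field morphism preserves supports. *)
Lemma deformation_irreducible (R : realType) (k K : fieldType) (l : nat)
    (j : {rmorphism k -> K}) (t : K) (P Q : {mpoly k[l]}) (F : {mpoly K[l]})
    (hstar : exists H : set 'rV[R]_l,
       [/\ is_hyperplane H, ~ H 0 & newton R P `<=` H])
    (ha : vertex_coord_gcd R P = 1%N)
    (hb0 : Q.@[fun _ => 0] != 0)
    (hb1 : newton R Q `<=` newton0 R P)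
    (hb2 : forall m, m \in msupp Q -> ~ vertices (newton R P) (exponent R m)) :
  t != 0 -> (forall m, F@_m = j P@_m - t * j Q@_m) -> irreducible F.
Proof.
move=> t0 FE; have [H [hypH H0 PH]] := hstar.
have [f fH] := hyperplane_form hypH H0.
have fP u : newton R P u -> f u = 1 by move=> /PH/fH.
(* At the origin every nonconstant monomial vanishes, so [Q] takes there the value of its constant
   coefficient. *)
have Qc0 : Q@_0 != 0.
  apply: contra_neq hb0 => Q0; rewrite mevalE big_seq big1 // => m mQ.
  have [m0|m0] := eqVneq m 0%MM; first by rewrite m0 Q0 mul0r.
  have [i mi] : exists i, m i != 0%N.
    apply/existsP; rewrite -negb_forall; apply: contra_neqN m0 => /forallP m0.
    by apply/mnmP => i; rewrite mnm0E; apply/eqP.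
  by rewrite (bigD1 i) //= expr0n (negbTE mi) mul0r mulr0.
have suppP m : m \in msupp P -> newton R P (exponent R m).
  by move=> mP; apply: sub_convex_hull; exists m.
apply: (pyramid_irreducible fP ha).
(* [P] has no constant term, since [f] is 1 on its support; that of [F] is thus [- t * j Q@_0]. *)
- rewrite mcoeff_msupp FE memN_msupp_eq0; last first.
    apply/negP => /suppP /fP /eqP.
    by rewrite exponent0 linear0 eq_sym oner_eq0.
  by rewrite rmorph0 sub0r oppr_eq0 mulf_neq0 // fmorph_eq0.
(* [Q] has no monomial at a vertex, so nothing cancels the coefficient of [P] there. *)
- move=> m; rewrite mem_filter => /andP[/asboolP mV mP].
  have /memN_msupp_eq0 Qm : m \notin msupp Q by apply/negP => /hb2.
  by rewrite mcoeff_msupp FE Qm rmorph0 mulr0 subr0 fmorph_eq0 -mcoeff_msupp.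
- move=> m; rewrite mcoeff_msupp FE => Fm.
  have [mP|mP] := boolP (m \in msupp P).
    by apply: sub_convex_hull; left; exists m.
  apply: hb1; apply: sub_convex_hull; exists m => //=; rewrite mcoeff_msupp.
  apply: contra_neq Fm => Qm.
  by rewrite Qm memN_msupp_eq0 // rmorph0 mulr0 subr0.
Qed.

Theorem corollary3p4 (R : realType) (k : closedFieldType) (l : nat)
    (hl : (2 <= l)%N) (P Q : {mpoly k[l]})
    (hstar : exists H : set 'rV[R]_l,
       [/\ is_hyperplane H, ~ H 0 & newton R P `<=` H])
    (ha : vertex_coord_gcd R P = 1%N)
    (hb0 : Q.@[fun _ => 0] != 0)
    (hb1 : newton R Q `<=` newton0 R P)
    (hb2 : forall m, m \in msupp Q -> ~ vertices (newton R P) (exponent R m)) :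
  generically_irreducible
    (map_mpoly polyC P - 'X *: map_mpoly polyC Q : {mpoly {poly k}[l]})
  /\ forall t : k, t != 0 -> irreducible (P - t *: Q).
Proof.
split=> [L iota _|t t0]; last first.
  apply: (deformation_irreducible (j := idfun) hstar ha hb0 hb1 hb2 t0) => // m.
  by rewrite mcoeffB mcoeffZ.
pose phi : {rmorphism {poly k} -> L} := iota \o @tofrac _.
apply: (deformation_irreducible (j := phi \o polyC) (t := phi 'X)
  hstar ha hb0 hb1 hb2).
  (* The indeterminate stays nonzero because k[t] embeds into k(t), and k(t) into [L]. *)
  by rewrite /phi /= fmorph_eq0 tofrac_eq0 polyX_eq0.
move=> m; rewrite (mcoeff_map_mpoly phi) mcoeffB mcoeffZ !mcoeff_map_mpoly.
by rewrite raddfB /= !rmorphM.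
Qed.
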